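(* Let $X = x_1,\ldots,x_n$ be a time series and $\epsilon\ge 0$. Let $\alpha_{opt}$ be the maximum compression ratio over all PLAs $\tilde{Y}$ of $X$ with $maxerr(X,\tilde{Y})\le\epsilon$, and let $\alpha_{PB}$ be the compression ratio of the output of Algorithm PointBound on $X$ with error bound $\epsilon$. Then $\alpha_{opt}/\alpha_{PB} \le 2$. The same holds with $segerr$ in place of $maxerr$ and Algorithm SegmentBound in place of Algorithm PointBound.
   Context: A line segment is $s=((i,y_i),(j,y_j))$ with integers $i<j$ and reals $y_i,y_j$; $[i,j]$ is its range, and it approximates index $k\in[i,j]$ by $\tilde{x}_k = y_i + \frac{k-i}{j-i}(y_j-y_i)$. A set of segments $\tilde{X}$ is a piecewise linear approximation (PLA) of $X$ if for every index $1\le k\le n$, either $k$ lies in the range of exactly one segment, or two segments share the same endpoint at index $k$. $maxerr(X,\tilde{X})=\max_k|x_k-\tilde{x}_k|$ and $segerr(X,\tilde{X})=\max_{s\in\tilde{X}}\sum_{k\in range(s)}(x_k-\tilde{x}_k)^2$. A PLA is represented by the set of its distinct endpoints (consecutive segments sharing an endpoint need it stored only once); its compression ratio is $n$ divided by the number of endpoints needed to represent it. Algorithm PointBound: with $poly(i,k)=\{(y,m): x_i-\epsilon\le y\le x_i+\epsilon,\ \frac{(x_k-\epsilon)-y}{k-i}\le m\le\frac{(x_k+\epsilon)-y}{k-i}\}$, set $P=poly(1,2)$, $i=1$, $j=3$; repeat: $P'=P\cap poly(i,j)$; if $P'\neq\emptyset$ set $P=P'$, $j=j+1$; else choose $(y,m)\in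 P$, output $((i,y),(j-1,y+(j-1-i)m))$, set $P=poly(j,j+1)$, $i=j$, $j=j+2$; at the end of input output a final segment from the current $P$. Algorithm SegmentBound: set $i=1$, $j=3$, $s=((1,x_1),(2,x_2))$; repeat: let $s'$ be the least-squares segment (range $[i,j]$, minimizing $\sum_{k=i}^j(x_k-\tilde{x}_k)^2$) for $x_i,\ldots,x_j$; if that minimum is $\le\epsilon$ set $s=s'$, $j=j+1$; else output $s$, set $i=j$, $j=j+2$, $s=((i,x_i),(i+1,x_{i+1}))$; at the end of input output the current $s$. *)

(* Defs.v *)
From HB Require Import structures.
From mathcomp Require Import all_boot all_order all_algebra.
From mathcomp Require Import classical_sets reals.

Set Implicit Arguments.
Unset Strict Implicit.
Unset Printing Implicit Defensive.

Import Order.TTheory GRing.Theory Num.Theory.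

Local Open Scope classical_set_scope.
Local Open Scope ring_scope.

Section PiecewiseLinearApproximation.
Variable R : realType.

(* A time series x_1, ..., x_n is a sequence of size n; [obs X k] is x_k, with *)
(* k counted from 1, and is only meaningful for 1 <= k <= size X.              *)
Definition obs (X : seq R) (k : nat) : R := nth 0 X k.-1.

(* ((i, y_i), (j, y_j)); the requirement i < j is [seg_wf]. *)
Definition segment : Type := ((int * R) * (int * R))%type.

Definition seg_wf (s : segment) : bool := s.1.1 < s.2.1.

Definition covers (k : int) (s : segment) : bool := s.1.1 <= k <= s.2.1.

Definition seg_at (s : segment) (k : int) : R :=
  s.1.2 + (k - s.1.1)%:~R / (s.2.1 - s.1.1)%:~R * (s.2.2 - s.1.2).

Definition is_endpoint (p : int * R) (s : segment) : bool :=
  (p == s.1) || (p == s.2).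

(* Finite sets of segments are duplicate-free sequences. *)
Definition is_pla (X : seq R) (Y : seq segment) : Prop :=
  [/\ uniq Y, all seg_wf Y &
      forall k : nat, (1 <= k <= size X)%N ->
        (exists s, [seq s <- Y | covers k%:Z s] = [:: s])
        \/ (exists s t y, [/\ [seq s <- Y | covers k%:Z s] = [:: s; t],
              is_endpoint (k%:Z, y) s & is_endpoint (k%:Z, y) t])].

(* When Y is a PLA, all the segments covering k agree at k, so the choice of *)
(* the first one is immaterial; the value 0 is never used for 1 <= k <= n.   *)
Definition approx (Y : seq segment) (k : nat) : R :=
  if [seq s <- Y | covers k%:Z s] is s :: _ then seg_at s k%:Z else 0.

(* The errors are nonnegative, so 0 is a harmless neutral element for max. *)
Definition maxerr (X : seq R) (Y : seq segment) : R :=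
  \big[Num.max/0]_(1 <= k < (size X).+1) `|obs X k - approx Y k|.

Definition segerr (X : seq R) (Y : seq segment) : R :=
  \big[Num.max/0]_(s <- Y)
    \sum_(1 <= k < (size X).+1 | covers k%:Z s) (obs X k - approx Y k) ^+ 2.

Definition endpoints (Y : seq segment) : seq (int * R) :=
  undup ([seq s.1 | s <- Y] ++ [seq s.2 | s <- Y]).

Definition compression_ratio (X : seq R) (Y : seq segment) : R :=
  (size X)%:R / (size (endpoints Y))%:R.

Definition feasible_ratios (err : seq R -> seq segment -> R) (X : seq R)
    (eps : R) : set R :=
  [set compression_ratio X Y | Y in [set Y | is_pla X Y /\ err X Y <= eps]].

Definition is_maximum (A : set R) (a : R) : Prop := A a /\ ubound A a.

(* An index k > size X carries no observation, hence no constraint. This only *)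
(* matters for poly(n, n + 1), used when the last segment starts at index n.  *)
Definition poly_region (X : seq R) (eps : R) (i k : nat) : set (R * R) :=
  [set p | obs X i - eps <= p.1 <= obs X i + eps /\
    ((k <= size X)%N ->
       ((obs X k - eps) - p.1) / (k%:R - i%:R) <= p.2
         <= ((obs X k + eps) - p.1) / (k%:R - i%:R))].

Definition pb_segment (i j : nat) (y m : R) : segment :=
  ((i%:Z, y), (j.-1%:Z, y + (j.-1%:R - i%:R) * m)).

(* [pb_run X eps i j P Z]: from the state (i, j, P), Algorithm PointBound can *)
(* output Z, for some choices of the points (y, m) of P.                      *)
Inductive pb_run (X : seq R) (eps : R) :
    nat -> nat -> set (R * R) -> seq segment -> Prop :=
| PbEnd i j P y m :
    (size X < j)%N -> P (y, m) ->
    pb_run X eps i j P [:: pb_segment i j y m]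
| PbExtend i j P Z :
    (j <= size X)%N -> P `&` poly_region X eps i j !=set0 ->
    pb_run X eps i j.+1 (P `&` poly_region X eps i j) Z ->
    pb_run X eps i j P Z
| PbEmit i j P y m Z :
    (j <= size X)%N -> P `&` poly_region X eps i j = set0 -> P (y, m) ->
    pb_run X eps j j.+2 (poly_region X eps j j.+1) Z ->
    pb_run X eps i j P (pb_segment i j y m :: Z).

Definition point_bound (X : seq R) (eps : R) (Z : seq segment) : Prop :=
  pb_run X eps 1 3 (poly_region X eps 1 2) Z.

Definition sum_sq (X : seq R) (i j : nat) (s : segment) : R :=
  \sum_(i <= k < j.+1) (obs X k - seg_at s k%:Z) ^+ 2.

Definition has_range (i j : nat) (s : segment) : Prop :=
  s.1.1 = i%:Z /\ s.2.1 = j%:Z.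

Definition least_squares (X : seq R) (i j : nat) (s : segment) : Prop :=
  has_range i j s /\
  forall t, has_range i j t -> sum_sq X i j s <= sum_sq X i j t.

(* ((i, x_i), (i + 1, x_(i + 1))); if i = n, then x_(i + 1) does not exist and *)
(* the second ordinate is arbitrary.                                          *)
Definition sb_init (X : seq R) (i : nat) (s : segment) : Prop :=
  [/\ has_range i i.+1 s, s.1.2 = obs X i &
      (i.+1 <= size X)%N -> s.2.2 = obs X i.+1].

Inductive sb_run (X : seq R) (eps : R) :
    nat -> nat -> segment -> seq segment -> Prop :=
| SbEnd i j s :
    (size X < j)%N -> sb_run X eps i j s [:: s]
| SbExtend i j s s' Z :
    (j <= size X)%N -> least_squares X i j s' -> sum_sq X i j s' <= eps ->
    sb_run X eps i j.+1 s' Z ->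
    sb_run X eps i j s Z
| SbEmit i j s s' s0 Z :
    (j <= size X)%N -> least_squares X i j s' -> eps < sum_sq X i j s' ->
    sb_init X j s0 -> sb_run X eps j j.+2 s0 Z ->
    sb_run X eps i j s (s :: Z).

Definition segment_bound (X : seq R) (eps : R) (Z : seq segment) : Prop :=
  exists2 s, sb_init X 1 s & sb_run X eps 1 3 s Z.

End PiecewiseLinearApproximation.

(* Main.v *)
Require Import Defs.
From mathcomp Require Import all_boot all_order all_algebra.
From mathcomp Require Import classical_sets reals.
From mathcomp Require Import zify ring lra.

Import Order.TTheory GRing.Theory Num.Theory.

Local Open Scope ring_scope.

(** Let i_1 < ... < i_m be the start indices of the m segments output by either
    greedy algorithm.  Segment r was closed because no single segment meets the
    error bound on [i_r, i_(r+1)]; hence no segment of a feasible PLA Y covers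
    two different start indices.  Sending i_r to the left endpoint of a segment
    of Y covering it is therefore injective, so Y has at least m endpoints,
    while the output has at most 2m. *)

Section Greedy.
Context {R : realType}.
Implicit Types (X : seq R) (Y Z : seq (segment R)) (s t : segment R).

Definition slope s : R := (s.2.2 - s.1.2) / (s.2.1 - s.1.1)%:~R.

(** Rebasing a segment at any index [i] turns it into the pair (ordinate at [i], slope), which is
    the form of the points of [poly_region]. *)
Lemma seg_at_slope s (i k : int) :
  seg_at s k = seg_at s i + (k%:~R - i%:~R) * slope s.
Proof. rewrite /seg_at /slope !intrB; ring. Qed.

Lemma seg_at_endpoint s (k : int) (y : R) :
  seg_wf s -> is_endpoint (k, y) s -> seg_at s k = y.
Proof.
rewrite /seg_wf /seg_at -subr_gt0 => wf_s.
have nz : (s.2.1 - s.1.1)%:~R != 0 :> R by rewrite intr_eq0 gt_eqF.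
case/orP => /eqP e; rewrite -e /= in nz *; first by rewrite subrr mul0r mul0r addr0.
by rewrite divff // mul1r addrC subrK.
Qed.

(** If two segments cover [k], both have an endpoint [(k, y)], so both take the value [y] there. *)
Lemma pla_approx X Y (k : nat) s :
  is_pla X Y -> (1 <= k <= size X)%N -> s \in Y -> covers k%:Z s ->
  approx Y k = seg_at s k%:Z.
Proof.
case=> _ /allP wfY cov /cov {}cov sY sk.
have : s \in [seq s <- Y | covers k%:Z s] by rewrite mem_filter sk.
rewrite /approx; case: cov => [[t ->]|[t [u [y [e tk uk]]]]].
  by rewrite inE => /eqP ->.
have wf v : v \in [:: t; u] -> seg_wf v.
  by rewrite -e mem_filter => /andP[_ /wfY].
rewrite e !inE => /orP[]/eqP -> //.
by rewrite !(@seg_at_endpoint _ _ y) // wf // !inE eqxx ?orbT.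
Qed.

Lemma pla_covered X Y (k : nat) :
  is_pla X Y -> (1 <= k <= size X)%N -> has (covers k%:Z) Y.
Proof.
case=> _ _ cov /cov {}cov; rewrite has_filter.
by case: cov => [[s ->]|[s [t [y [-> _ _]]]]].
Qed.

Lemma maxerr_seg_at X Y eps (k : nat) s :
  is_pla X Y -> maxerr X Y <= eps -> (1 <= k <= size X)%N ->
  s \in Y -> covers k%:Z s -> `|obs X k - seg_at s k%:Z| <= eps.
Proof.
move=> plaY errY kX sY sk; rewrite -(pla_approx X Y) //.
apply: le_trans errY; rewrite /maxerr.
by apply: (le_bigmax_seq 0 k xpredT (fun k => `|obs X k - approx Y k|));
  rewrite // mem_index_iota ltnS.
Qed.

(** Ranges are convex, so [s] covers all of [i, j]; the sum is then part of the sum for [s] in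
    [segerr], whose other terms are squares. *)
Lemma segerr_sum_sq X Y eps (i j : nat) s :
  is_pla X Y -> segerr X Y <= eps -> (0 < i)%N -> (j <= size X)%N ->
  s \in Y -> covers i%:Z s -> covers j%:Z s -> sum_sq X i j s <= eps.
Proof.
move=> plaY errY i_gt0 jX sY si sj.
pose F k := (obs X k - approx Y k) ^+ 2.
pose G s := \sum_(1 <= k < (size X).+1 | covers k%:Z s) F k.
have le_G : G s <= eps.
  by apply: le_trans errY; exact: (le_bigmax_seq 0 s xpredT G).
apply: le_trans le_G.
have [le_ji|ij] := leqP j.+1 i.
  by rewrite /sum_sq big_geq // sumr_ge0 // => k _; exact: sqr_ge0.
have -> : sum_sq X i j s = \sum_(i <= k < j.+1 | covers k%:Z s) F k.
  rewrite /sum_sq [RHS]big_mkcond; apply: eq_big_nat => k ikj.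
  have sk : covers k%:Z s by move: si sj; rewrite /covers; lia.
  by rewrite sk /F (pla_approx X Y _ s) //; lia.
rewrite /G [leRHS](big_cat_nat (n := i)) //=; last by lia.
rewrite [X in _ + X](big_cat_nat (n := j.+1)) //=; last by lia.
rewrite addrCA lerDl addr_ge0 // sumr_ge0 // => k _; exact: sqr_ge0.
Qed.

(** The order and bounds are built in so that the relation is transitive and a path yields pairwise
    separated, valid indices. *)
Definition separated X Y : rel nat := fun a b =>
  [&& (0 < a)%N, (a < b)%N, (b <= size X)%N &
      all (fun s => ~~ (covers a%:Z s && covers b%:Z s)) Y].

Lemma separated_trans X Y : transitive (separated X Y).
Proof.
move=> b a c /and4P[a0 ab _ /allP sepab] /and4P[_ bc cX _].
apply/and4P; split=> //; first exact: ltn_trans bc.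
apply/allP => s sY; apply: contra (sepab s sY).
by rewrite /covers; lia.
Qed.

Lemma separated_endpoints X Y i l :
  is_pla X Y -> (0 < i <= size X)%N -> path (separated X Y) i l ->
  ((size l).+1 <= size (endpoints Y))%N.
Proof.
move=> plaY iX pl; have lX : all (fun k => 0 < k <= size X)%N (i :: l).
  rewrite /= iX; have := order_path_min (separated_trans X Y) pl.
  by apply: sub_all => k /and4P[]; lia.
pose s0 : segment R := ((0, 0), (0, 0)).
pose cov (k : nat) := nth s0 Y (find (covers k%:Z) Y).
have covE k : (0 < k <= size X)%N -> cov k \in Y /\ covers k%:Z (cov k).
  move=> /(pla_covered X Y k plaY) hk; split; last exact: nth_find.
  by rewrite mem_nth // -has_find.
rewrite -[X in (X <= _)%N]/(size (i :: l)) -(size_map (fun k => (cov k).1)).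
apply: uniq_leq_size => [|p /mapP[k /(allP lX)/covE[kY _] ->]]; last first.
  by rewrite mem_undup mem_cat map_f.
rewrite uniq_pairwise pairwise_map.
have: pairwise (separated X Y) (i :: l).
  by rewrite -sorted_pairwise //; exact: separated_trans.
apply: sub_pairwise => a b /and4P[a0 ab bX /allP sep]; apply/eqP => e.
have [|_ ca] := covE a; first by lia.
have [|bY cb] := covE b; first by lia.
(* With a common left endpoint, at most [a], the segment chosen for [b] would also cover [a]. *)
move/negP: (sep _ bY); apply; move: ca cb; rewrite /covers e; lia.
Qed.

(** The invariant says that [P] contains every line from [i] compatible with the indices read so
    far, so an empty intersection rules out all lines on [i, j]. *)
Lemma pb_run_separated X Y eps i j P Z :
  is_pla X Y -> maxerr X Y <= eps -> pb_run X eps i j P Z ->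
  (0 < i < j)%N ->
  (forall p, (forall k, (i < k < j)%N -> poly_region X eps i k p) -> P p) ->
  exists2 l, path (separated X Y) i l & size Z = (size l).+1.
Proof.
move=> plaY errY; elim=> {i j P Z}.
- by move=> i j P y m *; exists [::].
- move=> i j P Z jX _ _ IH ij subP; apply: IH; first by lia.
  move=> p pP; split; last by apply: pP; lia.
  by apply: subP => k ikj; apply: pP; lia.
move=> i j P y m Z jX P0 _ _ IH ij subP.
have [||l pl sZ] := IH; first by lia.
  (* The new state is [(j, j.+2)], and [j.+1] is the only index strictly between. *)
  by move=> p; apply; lia.
exists (j :: l) => /=; last by rewrite sZ.
rewrite pl andbT; apply/and4P; split=> //; try lia.
apply/allP => s sY; apply/negP => /andP[si sj].
(* A segment of [Y] covering [i] and [j] would give a point of the empty intersection. *)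
have reg k : (i < k <= j)%N ->
    poly_region X eps i k (seg_at s i%:Z, slope s).
  move=> ikj; have sk : covers k%:Z s by move: si sj; rewrite /covers; lia.
  have ki : 0 < k%:R - i%:R :> R by rewrite subr_gt0 ltr_nat; lia.
  have := maxerr_seg_at X Y eps i s plaY errY ltac:(lia) sY si.
  have := maxerr_seg_at X Y eps k s plaY errY ltac:(lia) sY sk.
  rewrite (seg_at_slope s i%:Z k%:Z) !ler_norml /poly_region /= => ek ei.
  split=> [|_]; first by lra.
  by rewrite ler_pdivrMr // ler_pdivlMr //; lra.
suff : set0 (seg_at s i%:Z, slope s) by [].
rewrite -P0; split; last by apply: reg; lia.
by apply: subP => k ikj; apply: reg; lia.
Qed.

Lemma sb_run_separated X Y eps i j s Z :
  is_pla X Y -> segerr X Y <= eps -> sb_run X eps i j s Z ->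
  (0 < i < j)%N ->
  exists2 l, path (separated X Y) i l & size Z = (size l).+1.
Proof.
move=> plaY errY; elim=> {i j s Z}.
- by move=> i j s *; exists [::].
- by move=> i j s s' Z jX _ _ _ IH ij; apply: IH; lia.
move=> i j s s' s0 Z jX [_ ls] lt_eps _ _ IH ij.
have [|l pl sZ] := IH; first by lia.
exists (j :: l) => /=; last by rewrite sZ.
rewrite pl andbT; apply/and4P; split=> //; try lia.
apply/allP => t tY; apply/negP => /andP[ti tj].
(* Least squares compares segments of range exactly [i, j], whereas [t] may extend further: cut it
   down to that range. *)
pose t' : segment R := ((i%:Z, seg_at t i%:Z), (j%:Z, seg_at t j%:Z)).
have t'E k : seg_at t' k = seg_at t k.
  have ji : (j%:Z - i%:Z)%:~R != 0 :> R by rewrite intr_eq0; lia.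
  rewrite (seg_at_slope t i%:Z k) [LHS]/seg_at /= (seg_at_slope t i%:Z j%:Z).
  by rewrite [X in _ * X]addrAC subrr add0r -!intrB mulrA divfK.
have := ls t' (conj erefl erefl); apply/negP; rewrite -ltNge.
apply: le_lt_trans lt_eps; rewrite /sum_sq.
under eq_bigr do rewrite t'E.
by apply: (segerr_sum_sq X Y) => //; lia.
Qed.

Lemma compression_ratio_le2 X Y Z :
  (0 < size X)%N -> (0 < size Z)%N -> (size Z <= size (endpoints Y))%N ->
  compression_ratio X Y / compression_ratio X Z <= 2.
Proof.
move=> X0 Z0 ZY; rewrite /compression_ratio invf_div mulrC mulrA.
(* The length of [X] cancels, leaving the quotient of the endpoint counts of [Z] and [Y]. *)
rewrite divfK ?pnatr_eq0 -?lt0n // ler_pdivrMr ?ltr0n ?(leq_trans Z0) //.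
rewrite -natrM ler_nat.
apply: leq_trans (size_undup _) _.
by rewrite size_cat !size_map addnn -mul2n leq_mul2l.
Qed.

End Greedy.

Theorem theorem5 (R : realType) (X : seq R) (eps : R)
    (X_nonempty : (0 < size X)%N) (eps_ge0 : 0 <= eps) :
  (forall (alpha_opt : R) (Z : seq (segment R)),
     is_maximum (feasible_ratios (@maxerr R) X eps) alpha_opt ->
     point_bound X eps Z ->
     alpha_opt / compression_ratio X Z <= 2)
  /\
  (forall (alpha_opt : R) (Z : seq (segment R)),
     is_maximum (feasible_ratios (@segerr R) X eps) alpha_opt ->
     segment_bound X eps Z ->
     alpha_opt / compression_ratio X Z <= 2).
Proof.
(* The maximum is attained, which supplies the feasible [Y] to compare with. *)
split=> alpha Z [[Y [plaY errY] <-] _].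
  move=> /(pb_run_separated X Y _ _ _ _ _ plaY errY) [//||l pl sZ].
    by move=> p; apply.
  apply: compression_ratio_le2; rewrite ?sZ //.
  exact: separated_endpoints pl.
case=> s _ /(sb_run_separated X Y _ _ _ _ _ plaY errY) [//|l pl sZ].
apply: compression_ratio_le2; rewrite ?sZ //.
exact: separated_endpoints pl.
Qed.
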